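(* Let $X$ be an $\omega$-well-filtered space whose sobrification $X^s$ is first-countable. Then $X$ is sober.
   Context: For a $T_0$ space $X$, the specialization order is $x\le y$ iff $x\in\overline{\{y\}}$; a subset is saturated if it is an upper set in this order (equivalently, an intersection of open sets). $\mathsf{K}(X)$ is the set of all nonempty compact saturated subsets of $X$. A family $\mathcal K\subseteq\mathsf K(X)$ is filtered if it is nonempty and for all $K_1,K_2\in\mathcal K$ there is $K_3\in\mathcal K$ with $K_3\subseteq K_1\cap K_2$. A $T_0$ space $X$ is $\omega$-well-filtered if for every countable filtered family $\{K_i: i<\omega\}\subseteq\mathsf K(X)$ and every open $U\subseteq X$, $\bigcap_{i<\omega}K_i\subseteq U$ implies $K_{i_0}\subseteq U$ for some $i_0<\omega$. A nonempty set $A\subseteq X$ is irreducible if whenever $A\subseteq F_1\cup F_2$ with $F_1,F_2$ closed, then $A\subseteq F_1$ or $A\subseteq F_2$; $\mathsf{Irr}_c(X)$ is the set of irreducible closed subsets of $X$. $X$ is sober if every $F\in\mathsf{Irr}_c(X)$ is $\overline{\{a\}}$ for a unique $a\in X$. The sobrification $X^s$ is the set $\mathsf{Irr}_c(X)$ with the topology whose open sets are $\Diamond U=\{A\in\mathsf{Irr}_c(X): A\cap U\neq\emptyset\}$, $U$ open in $X$. *)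

(* Defs.v *)
From HB Require Import structures.
From mathcomp Require Import all_boot.
From mathcomp Require Import all_classical topology.

Set Implicit Arguments.
Unset Strict Implicit.
Unset Printing Implicit Defensive.

Local Open Scope classical_set_scope.

Section Topology.
Context {X : topologicalType}.

Definition specialization (x y : X) : Prop := closure [set y] x.

Definition saturated (A : set X) : Prop :=
  forall x y, specialization x y -> A x -> A y.

Definition compact_saturated : set (set X) :=
  [set K | [/\ K !=set0, compact K & saturated K]].

Definition filtered (F : set (set X)) : Prop :=
  F !=set0 /\
  forall K1 K2, F K1 -> F K2 -> exists2 K3, F K3 & K3 `<=` K1 `&` K2.

Definition irreducible_set (A : set X) : Prop :=
  A !=set0 /\
  forall F1 F2, closed F1 -> closed F2 ->
    A `<=` F1 `|` F2 -> A `<=` F1 \/ A `<=` F2.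

Definition irreducible_closed : set (set X) :=
  [set A | irreducible_set A /\ closed A].

End Topology.

(* The T0 axiom, part of the usual definition of this notion, is not included
   here: it has to be assumed separately as [kolmogorov_space X]. *)
Definition omega_well_filtered (X : topologicalType) : Prop :=
  forall K : nat -> set X,
    range K `<=` compact_saturated -> filtered (range K) ->
    forall U : set X, open U ->
      \bigcap_i K i `<=` U -> exists i, K i `<=` U.

Definition sober (X : topologicalType) : Prop :=
  forall F : set X, irreducible_closed F ->
    exists! a : X, F = closure [set a].

Definition first_countable (X : topologicalType) : Prop :=
  forall x : X, exists2 B : set (set X), countable B &
    B `<=` nbhs x /\ filter_from B id --> x.

Record sobrification (X : topologicalType) : Type := Sobrification {
  sobr_set :> set X;
  sobr_setP : irreducible_closed sobr_set
}.

HB.instance Definition _ (X : topologicalType) :=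
  gen_eqMixin (sobrification X).
HB.instance Definition _ (X : topologicalType) :=
  gen_choiceMixin (sobrification X).

Section SobrificationTopology.
Variable X : topologicalType.

Definition diamond (U : set X) : set (sobrification X) :=
  [set A | (A : set X) `&` U !=set0].

Definition sobr_open : set (set (sobrification X)) :=
  [set diamond U | U in open].

Let sobr_openT : sobr_open setT.
Proof.
exists setT; first exact: openT.
by apply/seteqP; split => // A _; rewrite /diamond /= setIT; case: (sobr_setP A) => -[].
Qed.

Let sobr_openI : setI_closed sobr_open.
Proof.
move=> _ _ [U oU <-] [V oV <-]; exists (U `&` V); first exact: openI.
apply/seteqP; split => [A [x [Ax [Ux Vx]]]|A [[x [Ax Ux]] [y [Ay Vy]]]].
  by split; exists x.
apply: contrapT => AUV.
have [[_ irrA] _] := sobr_setP A.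
have sA : (A : set X) `<=` ~` U `|` ~` V.
  by move=> z Az; rewrite -setCI => -[Uz Vz]; apply: AUV; exists z.
by have [/(_ _ Ax)|/(_ _ Ay)] :=
  irrA _ _ (open_closedC oU) (open_closedC oV) sA.
Qed.

Let sobr_open_bigU (I : Type) (f : I -> set (sobrification X)) :
  (forall i, sobr_open (f i)) -> sobr_open (\bigcup_i f i).
Proof.
move=> of_; have /choice[g gP] : forall i, exists U, open U /\ diamond U = f i.
  by move=> i; have [U oU Uf] := of_ i; exists U.
exists (\bigcup_i g i); first by apply: bigcup_open => i _; case: (gP i).
apply/seteqP; split => [A [x [Ax [i _ gx]]]|A [i _]].
  by exists i => //; have [_ <-] := gP i; exists x.
by have [_ <-] := gP i => -[x [Ax gx]]; exists x; split => //; exists i.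
Qed.

HB.instance Definition _ := isOpenTopological.Build (sobrification X)
  sobr_openT sobr_openI sobr_open_bigU.

Lemma sobrification_openE : @open (sobrification X) = sobr_open.
Proof. by []. Qed.

End SobrificationTopology.

(* Main.v *)
Require Import Defs.
From mathcomp Require Import all_boot.
From mathcomp Require Import all_classical topology.

Local Open Scope classical_set_scope.

(** First countability of the sobrification at [A] yields a sequence of points
of [A] eventually lying in every open set that meets [A].  Such a sequence
converges to each of its own terms, so the upper closures of its tails are
compact saturated, and by omega-well-filteredness their intersection meets [A].
Any point in the intersection that belongs to [A] is above infinitely many
terms, hence lies in every open set meeting [A]: it is generic in [A]. *)

Lemma open_specialization {X : topologicalType} (U : set X) (x y : X) :
  open U -> specialization x y -> U x -> U y.
Proof.
by move=> oU xy Ux; have [_ [-> //]] := xy U (open_nbhs_nbhs (conj oU Ux)).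
Qed.

Lemma specialization_trans {X : topologicalType} (x y z : X) :
  specialization x y -> specialization y z -> specialization x z.
Proof.
move=> xy yz; rewrite /specialization closureEonbhs => B C Bz [oC Cx].
exists z; split; first exact: Bz.
exact: (open_specialization _ _ _ oC yz (open_specialization _ _ _ oC xy Cx)).
Qed.

Lemma irreducible_closed_closure1 {X : topologicalType} (x : X) :
  irreducible_closed (closure [set x]).
Proof.
split; last exact: closed_closure.
split; first by exists x; exact: subset_closure.
move=> F1 F2 cF1 cF2 F12; have F12x : (F1 `|` F2) x.
  by apply: F12; exact: subset_closure.
have clF F : closed F -> F x -> closure [set x] `<=` F.
  move=> cF Fx; rewrite [F in _ `<=` F](closure_id F).1//.
  by apply: closureS => _ ->.
by case: F12x => ?; [left|right]; apply: clF.
Qed.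

Definition up_tail {X : topologicalType} (x : nat -> X) (k : nat) : set X :=
  [set y | exists2 n, (k <= n)%N & specialization (x n) y].

(** An open set around the limit [x k] contains almost all terms and, being an upper set, everything
    above them. The finitely many remaining terms are covered one by one. *)
Lemma compact_up_tail {X : topologicalType} (x : nat -> X) (k : nat) :
  x @ \oo --> x k -> compact (up_tail x k).
Proof.
move=> xk; apply/compact_near_coveringP => I F P FF PF.
have up_near n : (k <= n)%N -> exists2 U, open_nbhs (x n) U &
    \forall i \near F, U `<=` P i.
  move=> kn; have xn : up_tail x k (x n) by exists n => //; exact: subset_closure.
  have [[V G] /= [xV FG] VG] := PF _ xn.
  have [U [oU Ux] UV] : exists2 U, open_nbhs (x n) U & U `<=` V.
    by move: xV; rewrite nbhsE.
  by exists U => //; apply: filterS FG => i Gi y /UV Vy; exact: (VG (y, i)).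
have [N FN] : exists N, \forall i \near F, forall n y, (N <= n)%N ->
    specialization (x n) y -> P i y.
  have [U [oU Ux] FU] := up_near k (leqnn k).
  have [N _ NU] := xk U (open_nbhs_nbhs (conj oU Ux)).
  exists N; apply: filterS FU => i UP n y /NU Un xny.
  exact/UP/(open_specialization _ _ _ oU xny).
suff : \forall i \near F, forall n y, (k <= n)%N ->
    specialization (x n) y -> P i y.
  by apply: filterS => i iP y [n kn]; exact: iP.
(* The threshold [N] descends to [k]; each step down uses the neighbourhood of [x N] to handle the
   points above [x N]. *)
elim: N FN => [|N IHN] FN; first by apply: filterS FN => i iP n y _; exact: iP.
have [kN|Nk] := leqP k N; last first.
  by apply: filterS FN => i iP n y kn; apply: iP; exact: leq_trans kn.
apply: IHN; have [U [oU Ux] FU] := up_near N kN.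
apply: filterS2 FN FU => i iP UP n y; rewrite leq_eqVlt => /orP[/eqP <- xny|].
  exact/UP/(open_specialization _ _ _ oU xny).
exact: iP.
Qed.

Lemma compact_saturated_up_tail {X : topologicalType} (x : nat -> X) (k : nat) :
  x @ \oo --> x k -> compact_saturated (up_tail x k).
Proof.
move=> xk; split; last 2 first.
- exact: compact_up_tail.
- by move=> y z yz [n kn xny]; exists n => //; exact: specialization_trans yz.
by exists (x k), k => //; exact: subset_closure.
Qed.

Lemma filtered_up_tail {X : topologicalType} (x : nat -> X) :
  filtered (range (up_tail x)).
Proof.
split; first by exists (up_tail x 0), 0.
move=> _ _ [i _ <-] [j _ <-]; exists (up_tail x (maxn i j)).
  by exists (maxn i j).
by move=> y [n]; rewrite geq_max => /andP[ni nj] xny; split; exists n.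
Qed.

(** A basic neighbourhood [diamond U] of [A] contains the closure of every point of [A] lying in
    [U]. *)
Lemma nbhs_sobrification_closure1 {X : topologicalType} (A : sobrification X)
    (N : set (sobrification X)) :
  nbhs A N -> exists2 x, (A : set X) x &
    N (Sobrification (irreducible_closed_closure1 x)).
Proof.
rewrite nbhsE => -[_ [[U oU <-] [x [Ax Ux]]] UN]; exists x => //.
by apply: UN; exists x; split => //; exact: subset_closure.
Qed.

(** Choose [x n] in [A] with closure in the first [n] members of a countable base at [A]. These
    closures eventually enter [diamond U], and a point closure meets the open set [U] only if the
    point itself is in [U]. *)
Lemma first_countable_sobrification_seq {X : topologicalType}
    (A : sobrification X) :
  first_countable (sobrification X) ->
  exists2 x : nat -> X, forall n, (A : set X) (x n) &
    forall U, open U -> (A : set X) `&` U !=set0 ->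
      \forall n \near \oo, U (x n).
Proof.
move=> /(_ A)[B /pcard_surjP[g gB] [BA AB]].
(* The map [g] covers [B] but may take values outside it; the condition [B (g i)] discards those,
   which need not be neighbourhoods of [A]. *)
pose N n := \bigcap_(i in [set i | (i < n)%N /\ B (g i)]) g i.
have NA n : nbhs A (N n).
  elim: n => [|n IHn]; first by apply: filterS filterT => C _ i [].
  have [Bgn|nBgn] := pselect (B (g n)).
    apply: filterS2 IHn (BA _ Bgn) => C NC gC i /= [].
    rewrite ltnS leq_eqVlt => /orP[/eqP -> //|? ?]; exact: NC.
  apply: filterS IHn => C NC i /= [].
  by rewrite ltnS leq_eqVlt => /orP[/eqP -> //|? ?]; exact: NC.
have /choice[x xP] n := (exists2P _ _).1 (nbhs_sobrification_closure1 _ _ (NA n)).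
exists x => [n|U oU AU]; first by have [] := xP n.
have [|S BS SU] := AB (diamond U).
  by apply: open_nbhs_nbhs; split => //; exists U.
(* Only indices below [n] enter [N n], so [g i] counts from [i.+1] on. *)
have [i _ giS] := gB _ BS; exists i.+1 => // n /= ni; rewrite -giS in BS SU.
have [_ /(_ i (conj ni BS))/SU[y [/= xny Uy]]] := xP n.
exact: open_specialization xny Uy.
Qed.

Theorem theorem6p10 (X : topologicalType) (X_T0 : kolmogorov_space X)
    (X_omega_wf : omega_well_filtered X)
    (Xs_first_countable : first_countable (sobrification X)) :
  sober X.
Proof.
move=> A irrA; have [_ cA] := irrA.
have [x /= Ax xU] :=
  first_countable_sobrification_seq (Sobrification irrA) Xs_first_countable.
(* Every open neighbourhood of [x k] meets [A], namely at [x k]. *)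
have xk k : x @ \oo --> x k.
  move=> V /=; rewrite nbhsE => -[U [oU Uxk] UV].
  have /(xU _ oU) : A `&` U !=set0 by exists (x k).
  by apply: filterS => n /UV.
(* Otherwise the open complement of [A] would contain a whole tail, including its first term [x i],
   which lies in [A]. *)
have [a [tail_a Aa]] : (\bigcap_k up_tail x k) `&` A !=set0.
  apply: contrapT => tailA.
  have tailK : range (up_tail x) `<=` compact_saturated.
    by move=> _ [k _ <-]; exact: compact_saturated_up_tail.
  have tailAC : \bigcap_k up_tail x k `<=` ~` A.
    by move=> y ty Ay; apply: tailA; exists y.
  have [i iA] := X_omega_wf _ tailK (filtered_up_tail x) _ (closed_openC cA)
    tailAC.
  by apply: (iA (x i)) => //; exists i => //; exact: subset_closure.
have Aa_eq : A = closure [set a].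
  apply/seteqP; split => [y Ay|]; last first.
    by rewrite [A in _ `<=` A](closure_id A).1//; apply: closureS => _ ->.
  rewrite closureEonbhs => B U Ba [oU Uy]; exists a; split; first exact: Ba.
  have [N _ NU] : \forall n \near \oo, U (x n) by apply: xU => //; exists y.
  have [n Nn xna] := tail_a N I.
  exact: open_specialization xna (NU _ Nn).
(* Two generic points of [A] lie in each other's closure, so no open set separates them and T0
   identifies them. *)
exists a; split => // b Ab; apply: contrapT => /eqP /X_T0[V].
have clab : specialization a b by rewrite /specialization -Ab.
have clba : specialization b a.
  by rewrite /specialization -Aa_eq Ab; exact: subset_closure.
by rewrite !inE => -[[/clab[_ [-> Vb]]]|[/clba[_ [-> Va]]]]; apply.
Qed.
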